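(* Let $X$ be a real Hilbert space and let $A\colon X\rightrightarrows X$ be maximally monotone. The following are equivalent. (i) $A$ is uniformly monotone and uniformly continuous. (ii) $R_A$ is a contraction for large distances. (iii) Both $A$ and $A^{-1}$ are uniformly monotone with supercoercive moduli. (iv) Both $A$ and $A^{-1}$ are uniformly monotone. (v) $A^{-1}$ is uniformly monotone and uniformly continuous. (vi) $R_A$ and $R_{A^{-1}}$ are strongly nonexpansive.
   Context: For $A\colon X\rightrightarrows X$, $\operatorname{gra}A=\{(x,x^* )\in X\times X : x^*\in Ax\}$, and $A^{-1}$ is the inverse operator, $x\in A^{-1}x^*\Leftrightarrow x^*\in Ax$. The resolvent is $J_A=(\mathrm{Id}+A)^{-1}$ and the reflected resolvent is $R_A=2J_A-\mathrm{Id}$; for maximally monotone $A$ these are single-valued and defined on all of $X$. A modulus is an increasing (nondecreasing) function $\phi\colon[0,\infty)\to[0,+\infty]$ that vanishes only at $0$; it is supercoercive if $\phi(t)/t\to+\infty$ as $t\to+\infty$. $A$ is uniformly monotone with modulus $\phi$ if $\langle x-y,x^*-y^*\rangle\ge\phi(\|x-y\|)$ for all $(x,x^* ),(y,y^* )\in\operatorname{gra}A$; it is uniformly monotone if this holds for some modulus $\phi$. An operator on $X$ is called uniformly continuous if it is single-valued, defined on all of $X$, and uniformly continuous as a map $X\to X$. $T\colon X\to X$ is strongly nonexpansive if it is nonexpansive (i.e. $\|Tx-Ty\|\le\|x-y\|$ for all $x,y$) and, for all sequences $(x_n),(y_n)$ in $X$, if $(x_n-y_n)$ is bounded and $\|x_n-y_n\|-\|Tx_n-Ty_n\|\to0$,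 then $(x_n-y_n)-(Tx_n-Ty_n)\to0$. $T$ is a contraction for large distances if for each $\epsilon>0$ there exists $K_\epsilon<1$ such that $\|Tx-Ty\|\le K_\epsilon\|x-y\|$ whenever $\|x-y\|\ge\epsilon$. *)

(* Defs.v *)
From HB Require Import structures.
From mathcomp Require Import all_boot all_order all_algebra.
From mathcomp Require Import all_classical all_reals all_analysis.
Import Order.TTheory GRing.Theory Num.Theory.
Import numFieldNormedType.Exports.

Set Implicit Arguments.
Unset Strict Implicit.
Unset Printing Implicit Defensive.

Local Open Scope classical_set_scope.
Local Open Scope ring_scope.

(* A set-valued operator A : X => X is a function X -> set X, so that
   [A x u] reads u \in A x. *)

Section SetValuedOperators.
Context {R : realType} {X : normedModType R}.
Implicit Type A : X -> set X.

Definition gra A : set (X * X) := [set p | A p.1 p.2].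

Definition invop A : X -> set X := fun u => [set x | A x u].

Definition id_plus A : X -> set X := fun x => [set x + u | u in A x].

Definition resolvent A : X -> set X := invop (id_plus A).

Definition reflected_resolvent A : X -> set X :=
  fun x => [set 2%:R *: u - x | u in resolvent A x].

(* A is single-valued, defined on all of X, and the resulting map X -> X
   satisfies P. *)
Definition is_map_such_that (P : (X -> X) -> Prop) A :=
  exists2 T : X -> X, (forall x, A x = [set T x]) & P T.

Definition uniformly_continuous_op A := is_map_such_that (@unif_continuous X X) A.

End SetValuedOperators.

Section Monotonicity.
Context {R : realType} {X : normedModType R}.
Variable dot : {dot X for idfun}.
Implicit Types (A B : X -> set X) (phi : R -> \bar R).

Definition monotone_op A :=
  forall x y u v : X, gra A (x, u) -> gra A (y, v) ->
    0 <= dot (x - y) (u - v).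

Definition maximally_monotone A :=
  monotone_op A /\
  forall B, monotone_op B -> gra A `<=` gra B -> gra B = gra A.

Definition uniformly_monotone_with phi A :=
  forall x y u v : X, gra A (x, u) -> gra A (y, v) ->
    (phi `|x - y|%R <= (dot (x - y) (u - v))%:E)%E.

End Monotonicity.

Section Moduli.
Context {R : realType}.
Implicit Type phi : R -> \bar R.

(* Moduli are functions [0, +oo[ -> [0, +oo]; the values of phi at negative
   reals are irrelevant. *)
Definition modulus phi :=
  [/\ forall t, 0 <= t -> (0%:E <= phi t)%E,
      forall s t, 0 <= s -> s <= t -> (phi s <= phi t)%E &
      forall t, 0 <= t -> (phi t = 0%:E <-> t = 0)].

Definition supercoercive phi :=
  (phi t * (t^-1)%:E)%E @[t --> +oo%R] --> +oo%E.

End Moduli.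

Section UniformMonotonicity.
Context {R : realType} {X : normedModType R}.
Variable dot : {dot X for idfun}.
Implicit Type A : X -> set X.

Definition uniformly_monotone A :=
  exists2 phi : R -> \bar R, modulus phi & uniformly_monotone_with dot phi A.

Definition supercoercively_uniformly_monotone A :=
  exists phi : R -> \bar R,
    [/\ modulus phi, supercoercive phi & uniformly_monotone_with dot phi A].

End UniformMonotonicity.

Section Maps.
Context {R : realType} {X : normedModType R}.
Implicit Type T : X -> X.

Definition nonexpansive T := forall x y, `|T x - T y| <= `|x - y|.

Definition strongly_nonexpansive T :=
  nonexpansive T /\
  forall x y : nat -> X,
    bounded_fun (fun n => x n - y n) ->
    `|x n - y n| - `|T (x n) - T (y n)| @[n --> \oo] --> (0 : R) ->
    (x n - y n) - (T (x n) - T (y n)) @[n --> \oo] --> (0 : X).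

Definition contraction_for_large_distances T :=
  forall e : R, 0 < e -> exists2 K : R, K < 1 &
    forall x y, e <= `|x - y| -> `|T x - T y| <= K * `|x - y|.

End Maps.

(* Main.v *)
(* If u \in A x, v \in A y and N = R_A, then N (x + u) = x - u and
   |(x+u) - (y+v)|^2 - |(x-u) - (y-v)|^2 = 4 <x - y, u - v>, so all conditions
   speak about the defect |z - w| - |N z - N w|.  Each turns out to be
   equivalent to a positive lower bound on the defect over {|z - w| >= e} for
   every e > 0.  The defect is superadditive along segments, hence such a bound
   at the distance e grows linearly with |z - w|, which gives the contraction
   estimate and quadratic, in particular supercoercive, moduli for A and A^-1.
   Since R_(A^-1) = - R_A, the situation is symmetric in A and A^-1.
   That N is defined everywhere is Minty's theorem; here a minimizer (x, u) of
   the Fitzpatrick function of A plus (|x|^2 + |u|^2) / 2 satisfies x + u = 0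
   and u \in A x. *)
Require Import Defs.
From HB Require Import structures.
From mathcomp Require Import all_boot all_order all_algebra.
From mathcomp Require Import all_classical all_reals all_analysis.
From mathcomp Require Import ring lra.
Import Order.TTheory GRing.Theory Num.Theory.
Import numFieldNormedType.Exports.

Set Implicit Arguments.
Unset Strict Implicit.
Unset Printing Implicit Defensive.

Local Open Scope classical_set_scope.
Local Open Scope ring_scope.

(** * Inner product rules and the Cauchy-Schwarz inequality *)

Section InnerProduct.
Context {R : realType} {X : normedModType R} (dot : {dot X for idfun}).
Implicit Types x y z : X.

Lemma dotC x y : dot x y = dot y x.
Proof. by rewrite (hermC dot) expr0 mul1r. Qed.

Lemma dotDl x y z : dot (x + y) z = dot x z + dot y z.
Proof. exact: linearDl. Qed.

Lemma dotDr x y z : dot x (y + z) = dot x y + dot x z.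
Proof. exact: linearDr. Qed.

Lemma dotNl x y : dot (- x) y = - dot x y.
Proof. exact: linearNl. Qed.

Lemma dotNr x y : dot x (- y) = - dot x y.
Proof. exact: linearNr. Qed.

Lemma dotZl (a : R) x y : dot (a *: x) y = a * dot x y.
Proof. exact: linearZl_LR. Qed.

Lemma dotZr (a : R) x y : dot x (a *: y) = a * dot x y.
Proof. by rewrite dotC dotZl dotC. Qed.

Definition dotE := (dotDl, dotDr, dotNl, dotNr, dotZl, dotZr).

Lemma dotxx_ge0 x : 0 <= dot x x.
Proof.
have [->|/neq0_dnorm_gt0/ltW //] := eqVneq x 0.
by rewrite -(scale0r x) dotZl mul0r.
Qed.

Hypothesis norm_dot : forall x, `|x| = Num.sqrt (dot x x).

Lemma normX2 x : `|x| ^+ 2 = dot x x.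
Proof. by rewrite norm_dot sqr_sqrtr // dotxx_ge0. Qed.

Lemma CauchySchwarz x y : dot x y <= `|x| * `|y|.
Proof.
have [->|x0] := eqVneq x 0; first by rewrite -(scale0r y) dotZl mul0r mulr_ge0.
have [->|y0] := eqVneq y 0; first by rewrite -(scale0r x) dotZr mul0r ?mulr_ge0.
have h := dotxx_ge0 (`|y| *: x - `|x| *: y).
rewrite !dotE -!normX2 (dotC y x) in h.
have p : 0 < `|x| * `|y| by rewrite mulr_gt0 // normr_gt0.
rewrite -(ler_pM2l p).
nra.
Qed.

Lemma CauchySchwarz_abs x y : `|dot x y| <= `|x| * `|y|.
Proof.
rewrite ler_norml lerNl -dotNl -(normrN x).
by rewrite {1}CauchySchwarz normrN CauchySchwarz.
Qed.

Lemma cvg_dotl (x : nat -> X) (l y : X) :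
  x @ \oo --> l -> dot (x n) y @[n --> \oo] --> dot l y.
Proof.
move=> xl; apply/cvgrPdist_le => e e0.
have k0 : 0 < `|y| + 1 by rewrite ltr_wpDl.
have /cvgrPdist_le/(_ _ (divr_gt0 e0 k0)) := xl.
apply: filterS => n hn.
rewrite -dotNl -dotDl; apply: (le_trans (CauchySchwarz_abs _ _)).
apply: (@le_trans _ _ (`|l - x n| * (`|y| + 1))).
  by rewrite ler_wpM2l // lerDl.
by rewrite -ler_pdivlMr.
Qed.

End InnerProduct.

Lemma cauchy_cvgn {R : realType} {X : completeNormedModType R} (x : nat -> X) :
  (forall e, 0 < e -> exists N, forall n, (N <= n)%N -> `|x N - x n| < e) ->
  cvgn x.
Proof.
move=> xP; apply/cauchy_cvgP/cauchyP => e /xP[N Nx].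
exists (x N); exists N => // n /= Nn.
by rewrite -ball_normE; apply: Nx.
Qed.

(** * Minty's theorem through the Fitzpatrick function *)

Section Minty.
Context {R : realType} {X : completeNormedModType R}.
Variable dot : {dot X for idfun}.
Hypothesis norm_dot : forall x : X, `|x| = Num.sqrt (dot x x).
Implicit Types (A : X -> set X) (x y u v : X).

(** A pair monotonically related to the whole graph can be adjoined to it without destroying
    monotonicity, so maximality forces it to be there already. *)
Lemma maximally_monotoneP A : maximally_monotone dot A <->
  monotone_op dot A /\
  forall x u, (forall y v, A y v -> 0 <= dot (x - y) (u - v)) -> A x u.
Proof.
split=> -[mA maxA]; split=> //.
- move=> x u xu; pose B z := A z `|` [set w | z = x /\ w = u].
  have AB : gra A `<=` gra B by move=> [z w] ?; left.
  have mB : monotone_op dot B.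
    move=> y z v w /= [Ayv|[/= -> ->]] [Azw|[/= -> ->]].
    + exact: mA Ayv Azw.
    + by rewrite -[y - x]opprB -[v - u]opprB dotNl dotNr opprK xu.
    + exact: xu.
    + by rewrite !subrr dotxx_ge0.
  suff : gra A (x, u) by [].
  by rewrite -(maxA B mB AB); right.
- move=> B mB AB; apply/seteqP; split=> // -[x u] Bxu; apply: maxA => y v Ayv.
  by apply: mB Bxu (AB (y, v) Ayv).
Qed.

Lemma maximally_monotone_neq0 A : maximally_monotone dot A -> exists x u, A x u.
Proof.
move=> /maximally_monotoneP[_ maxA]; apply: contrapT => h.
by apply: (h); exists 0, 0; apply: maxA => y v Ayv; case: h; exists y, v.
Qed.

Lemma maximally_monotone_inv A :
  maximally_monotone dot A -> maximally_monotone dot (invop A).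
Proof.
move=> /maximally_monotoneP[mA maxA]; apply/maximally_monotoneP; split.
  by move=> x y u v Aux Avy; rewrite dotC; apply: mA Aux Avy.
by move=> x u h; apply: maxA => y v Ayv; rewrite dotC; apply: h.
Qed.

(** Reduces Minty's theorem at [z] to the case [z = 0]. *)
Lemma maximally_monotone_translate A z : maximally_monotone dot A ->
  maximally_monotone dot (fun x => [set u | A x (u + z)]).
Proof.
have addKB u v : u + z - (v + z) = u - v by rewrite opprD addrACA subrr addr0.
move=> /maximally_monotoneP[mA maxA]; apply/maximally_monotoneP; split.
  move=> x y u v Axu Ayv.
  by rewrite -(addKB u v); apply: (mA x y (u + z) (v + z)).
move=> x u h; apply: maxA => y v Ayv.
by rewrite -[v](subrK z) addKB; apply: h; rewrite /= subrK.
Qed.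

(* [penalized_fitzpatrick A s x u] says that F(x,u) + (|x|^2 + |u|^2) / 2 <= s,
   where F(x,u) = sup {<x,v> + <y,u> - <y,v> : v \in A y} is the Fitzpatrick
   function of A. *)
Definition penalized_fitzpatrick A (s : R) x u := forall y v, A y v ->
  dot x v + dot y u - dot y v + (dot x x + dot u u) / 2 <= s.

(** [F] is a supremum of affine functions, hence convex, and the quadratic penalty contributes the
    exact gain of strong convexity. *)
Lemma penalized_fitzpatrick_convex A (l s t : R) x u y v : 0 <= l <= 1 ->
  penalized_fitzpatrick A s x u -> penalized_fitzpatrick A t y v ->
  penalized_fitzpatrick A
    (l * s + (1 - l) * t
       - l * (1 - l) / 2 * (dot (x - y) (x - y) + dot (u - v) (u - v)))
    (l *: x + (1 - l) *: y) (l *: u + (1 - l) *: v).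
Proof.
move=> /andP[l0 l1] xu yv z w Azw.
have l10 : 0 <= 1 - l by rewrite subr_ge0.
have := lerD (ler_wpM2l l0 (xu z w Azw)) (ler_wpM2l l10 (yv z w Azw)).
rewrite -subr_ge0 => h; rewrite -subr_ge0; apply: le_trans h _.
by rewrite !dotE (dotC dot y x) (dotC dot v u) le_eqVlt; apply/predU1P; left; field.
Qed.

(** Were the bound smaller, [(x, u)] would be monotonically related to the graph, hence lie in it,
    and testing at [(x, u)] itself would give a contradiction. *)
Lemma penalized_fitzpatrick_ge A (s : R) x u : maximally_monotone dot A ->
  penalized_fitzpatrick A s x u -> dot x u + (dot x x + dot u u) / 2 <= s.
Proof.
move=> /maximally_monotoneP[_ maxA] xu; rewrite leNgt; apply/negP => s_lt.
suff /xu : A x u by lra.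
apply: maxA => y v /xu; rewrite !dotE; lra.
Qed.

Lemma penalized_fitzpatrick_graph A y v : monotone_op dot A -> A y v ->
  penalized_fitzpatrick A (dot y v + (dot y y + dot v v) / 2) y v.
Proof.
by move=> mA Ayv z w Azw; have := mA _ _ _ _ Ayv Azw; rewrite !dotE /=; lra.
Qed.

(** Strong convexity makes minimizing sequences Cauchy. Every member of the supremum defining [F] is
    continuous, so its bound passes to the limit. *)
Lemma penalized_fitzpatrick_min A : maximally_monotone dot A ->
  exists m x u, penalized_fitzpatrick A m x u /\
    forall s y v, penalized_fitzpatrick A s y v -> m <= s.
Proof.
move=> maxA; have [mA _] := maxA.
pose E := [set s | exists x u, penalized_fitzpatrick A s x u].
have E0 : E !=set0.
  have [x [u Axu]] := maximally_monotone_neq0 maxA.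
  by eexists; exists x, u; apply: penalized_fitzpatrick_graph.
have lbE : has_lbound E.
  exists 0 => s [x [u /penalized_fitzpatrick_ge]] /(_ maxA); apply: le_trans.
  by have := dotxx_ge0 dot (x + u); rewrite !dotE (dotC dot u x); lra.
set m := inf E.
have minm s y v : penalized_fitzpatrick A s y v -> m <= s.
  by move=> syv; apply: ge_inf => //; exists y, v.
have approx n : exists p : X * X,
    penalized_fitzpatrick A (m + n.+1%:R^-1) p.1 p.2.
  have [//|s [x [u sxu]] sm] := @inf_adherent _ E n.+1%:R^-1 _ (conj E0 lbE).
  by exists (x, u) => y v Ayv; apply: le_trans (ltW sm); apply: sxu.
have [p pP] := choice approx.
have close N n : (N <= n)%N ->
    `|(p N).1 - (p n).1| ^+ 2 + `|(p N).2 - (p n).2| ^+ 2 <= 8 * N.+1%:R^-1.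
  move=> Nn; rewrite !(normX2 norm_dot).
  (* The value at the midpoint is at least [m], so an eighth of the squared distance is at most the
     mean of the two excesses over [m]. *)
  have half : 0 <= (2^-1 : R) <= 1 by lra.
  have /minm := penalized_fitzpatrick_convex half (pP N) (pP n).
  have : n.+1%:R^-1 <= N.+1%:R^-1 :> R by rewrite lef_pV2 ?posrE // ler_nat.
  set a := N.+1%:R^-1; set b := n.+1%:R^-1; set d := dot _ _; set d' := dot _ _.
  rewrite -/a -/b -/d -/d'.
  lra.
have small (e : R) : 0 < e -> exists N : nat, 8 * N.+1%:R^-1 < e ^+ 2 :> R.
  move=> e0; have e8 : 0 < e ^+ 2 / 8 by rewrite divr_gt0 // exprn_gt0.
  have [N _ /(_ N (leqnn N)) /= HN] := near_infty_natSinv_lt (PosNum e8).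
  by exists N; rewrite mulrC -ltr_pdivlMr.
have cauchy_of (f : X * X -> X) :
    (forall N n, (N <= n)%N -> `|f (p N) - f (p n)| ^+ 2 <= 8 * N.+1%:R^-1) ->
    cvgn (f \o p).
  move=> fP; apply: cauchy_cvgn => e e0; have [N Ne] := small e e0.
  exists N => n Nn; rewrite -ltr_sqr ?nnegrE ?(ltW e0) //.
  by apply: le_lt_trans Ne; apply: fP.
have /cauchy_of/cvg_ex[x xP] : forall N n, (N <= n)%N ->
    `|(p N).1 - (p n).1| ^+ 2 <= 8 * N.+1%:R^-1.
  by move=> N n /close; apply: le_trans; rewrite lerDl exprn_ge0.
have /cauchy_of/cvg_ex[u uP] : forall N n, (N <= n)%N ->
    `|(p N).2 - (p n).2| ^+ 2 <= 8 * N.+1%:R^-1.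
  by move=> N n /close; apply: le_trans; rewrite lerDr exprn_ge0.
exists m, x, u; split=> // y v Ayv.
have lhs : dot (p n).1 v + dot (p n).2 y - dot y v
    + (`|(p n).1| ^+ 2 + `|(p n).2| ^+ 2) / 2 @[n --> \oo] -->
    dot x v + dot u y - dot y v + (`|x| ^+ 2 + `|u| ^+ 2) / 2.
  apply: cvgD.
    apply: cvgB; last exact: cvg_cst.
    by apply: cvgD; apply: cvg_dotl.
  by apply: cvgMl; apply: cvgD; rewrite !expr2; apply: cvgM; apply: cvg_norm.
have rhs : m + n.+1%:R^-1 @[n --> \oo] --> m + 0.
  by apply: cvgD; [exact: cvg_cst|exact: cvg_harmonic].
rewrite -(normX2 norm_dot x) -(normX2 norm_dot u) (dotC dot y u) -[m]addr0.
apply: ler_cvg_to lhs rhs _; apply: nearW => n.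
by rewrite !(normX2 norm_dot) (dotC dot _ y); apply: pP.
Qed.

(** At a minimizer [(x, u)], strong convexity along the segment to a graph point [(y, v)] yields |x
    + u|^2 <= <y + u, v + x>. Hence [(- u, - x)] is monotonically related to the graph and belongs
    to it; inserting it for [(y, v)] gives x + u = 0. *)
Lemma maximally_monotone_opp A :
  maximally_monotone dot A -> exists x, A x (- x).
Proof.
move=> maxA; have [mA maxA'] := (maximally_monotoneP A).1 maxA.
have [m [x [u [mxu minm]]]] := penalized_fitzpatrick_min maxA.
have m_ge := penalized_fitzpatrick_ge maxA mxu.
have key y v : A y v -> dot (x + u) (x + u) <= dot (y + u) (v + x).
  move=> Ayv; have syv := penalized_fitzpatrick_graph mA Ayv.
  set s := (X in penalized_fitzpatrick A X y v) in syv.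
  set D := dot (y - x) (y - x) + dot (v - u) (v - u).
  suff : D / 2 <= s - m.
    rewrite /D /s !dotE ?(dotC dot u x) ?(dotC dot y x) ?(dotC dot y u).
    rewrite ?(dotC dot v x) ?(dotC dot v u) ?(dotC dot v y).
    lra.
  have convex (l : R) : 0 < l <= 1 -> (1 - l) * (D / 2) <= s - m.
    move=> /andP[l0 l1].
    have l01 : 0 <= l <= 1 by rewrite ltW.
    have /minm := penalized_fitzpatrick_convex l01 syv mxu.
    by rewrite -/D => h; rewrite -(ler_pM2l l0); lra.
  have D0 : 0 <= D by rewrite addr_ge0 ?dotxx_ge0.
  rewrite leNgt; apply/negP => gap.
  have sm : 0 <= s - m by rewrite subr_ge0; apply: minm syv.
  (* Replaces letting [l] tend to 0: [l * D] is the assumed gap, so [(1 - l) * (D / 2)] still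
     exceeds [s - m] by half of it. *)
  pose l := (D / 2 - (s - m)) / D.
  have Dpos : 0 < D by lra.
  have lD : l * D = D / 2 - (s - m) by rewrite /l divfK // gt_eqF.
  have /convex : 0 < l <= 1.
    by rewrite /l divr_gt0 ?ler_pdivrMr //=; lra.
  lra.
have Aux : A (- u) (- x).
  apply: maxA' => y v /key h.
  by apply: le_trans (dotxx_ge0 dot (x + u)) (le_trans h _); rewrite !dotE; lra.
have := key _ _ Aux; rewrite !addNr -(normX2 norm_dot).
rewrite -(scale0r x) dotZl mul0r => xu0.
have /eqP : x + u = 0.
  by apply/eqP; rewrite -normr_eq0 -sqrf_eq0 eq_le xu0 exprn_ge0.
by rewrite addr_eq0 => /eqP xu; exists x; move: Aux; rewrite -xu.
Qed.

Lemma minty A z : maximally_monotone dot A -> exists x, A x (z - x).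
Proof.
move=> /(@maximally_monotone_translate A z)/maximally_monotone_opp[x] /=.
by rewrite addrC; exists x.
Qed.

End Minty.

(** * Maps with a defect bounded below at large distances *)

Section ShrinkingMaps.
Context {R : realType} {X : normedModType R}.
Implicit Types (T : X -> X) (x y z w : X).

Definition shrinking T := forall e : R, 0 < e -> exists2 c : R, 0 < c &
  forall z w, e <= `|z - w| -> `|T z - T w| + c <= `|z - w|.

Lemma shrinking_nonexpansive T : shrinking T -> nonexpansive T.
Proof.
move=> sT z w; have [->|zw] := eqVneq z w; first by rewrite !subrr.
have /sT[c c0 /(_ z w (lexx _))] : 0 < `|z - w| by rewrite normr_gt0 subr_eq0.
by apply: le_trans; rewrite lerDl ltW.
Qed.

Lemma shrinkingN T : shrinking T -> shrinking (fun z => - T z).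
Proof.
move=> sT e /sT[c c0 cT]; exists c => // z w.
by rewrite -opprD normrN; apply: cT.
Qed.

Lemma shrinking_translate T y : shrinking T -> shrinking (fun z => T z + y).
Proof.
move=> sT e /sT[c c0 cT]; exists c => // z w.
by rewrite opprD addrACA subrr addr0; apply: cT.
Qed.

Lemma segment_point z w (e : R) : 0 < e -> e <= `|z - w| ->
  exists y, `|z - y| = e /\ `|y - w| = `|z - w| - e.
Proof.
move=> e0 ezw; have zw0 : 0 < `|z - w| by apply: lt_le_trans ezw.
pose t := e / `|z - w|.
have t01 : 0 <= t <= 1 by rewrite divr_ge0 ?ler_pdivrMr ?mul1r //= ltW.
have tzw : t * `|z - w| = e by rewrite divfK // gt_eqF.
exists (z - t *: (z - w)); split.
  by rewrite opprB addrC subrK normrZ ger0_norm ?tzw //; case/andP: t01.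
rewrite addrAC -{1}[z - w]scale1r -scalerBl normrZ ger0_norm.
  by rewrite mulrBl mul1r tzw.
by rewrite subr_ge0; case/andP: t01.
Qed.

(* The defect |z - w| - |Tz - Tw| of a nonexpansive map is superadditive along
   segments. *)
Lemma defect_iter T (e c : R) n z w : nonexpansive T -> 0 < e ->
  (forall x y, `|x - y| = e -> `|T x - T y| + c <= `|x - y|) ->
  n%:R * e <= `|z - w| -> `|T z - T w| + n%:R * c <= `|z - w|.
Proof.
move=> nT e0 eT; elim: n z w => [|n IHn] z w.
  by rewrite !mul0r addr0 => _; apply: nT.
rewrite -natr1 !mulrDl !mul1r => nzw.
have ne0 : 0 <= n%:R * e by rewrite mulr_ge0 // ltW.
have [y [zy yw]] : exists y, `|z - y| = e /\ `|y - w| = `|z - w| - e.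
  by apply: segment_point => //; lra.
have := eT z y zy; have /IHn : n%:R * e <= `|y - w| by rewrite yw; lra.
have := ler_distD (T y) (T z) (T w); rewrite zy yw; lra.
Qed.

(** A longer segment contains an initial piece of length [e], which already has defect [c]; by
    nonexpansiveness the rest cannot reduce it. *)
Lemma shrinking_sphere T : nonexpansive T ->
  (forall e : R, 0 < e -> exists2 c : R, 0 < c &
     forall z w, `|z - w| = e -> `|T z - T w| + c <= `|z - w|) ->
  shrinking T.
Proof.
move=> nT sT e e0; have [c c0 cT] := sT e e0; exists c => // z w ezw.
by have := @defect_iter T e c 1 z w nT e0 cT; rewrite !mul1r; apply.
Qed.

Lemma contraction_shrinking T :
  contraction_for_large_distances T -> shrinking T.
Proof.
move=> cT e e0; have [K K1 KT] := cT e e0.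
have K10 : 0 < 1 - K by rewrite subr_gt0.
exists ((1 - K) * e) => [|z w ezw]; first by rewrite mulr_gt0.
have := KT z w ezw.
have : (1 - K) * e <= (1 - K) * `|z - w| by rewrite ler_pM2l.
lra.
Qed.

Lemma shrinking_contraction T :
  shrinking T -> contraction_for_large_distances T.
Proof.
move=> sT e e0; have [c c0 cT] := sT e e0.
(* The segment holds [n] pieces of length [e], each losing [c]. As n >= 1, its length is at most (n
   + 1) e <= 2 n e, so the loss n c is at least c / (2 e) times the length. *)
exists (1 - c / (2 * e)); first by rewrite ltrBlDr ltrDl divr_gt0 // mulr_gt0.
move=> z w ezw; set d := `|z - w|.
have d0 : 0 <= d / e by rewrite divr_ge0 ?normr_ge0 ?ltW.
have /andP[nd dn] := truncn_itv d0; set n := Num.truncn _ in nd dn.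
have n1 : 1 <= n%:R :> R.
  by rewrite (ler_nat _ 1) truncn_gt0 ler_pdivlMr // mul1r.
have nT : n%:R * e <= `|z - w| by rewrite -ler_pdivlMr.
have h : `|T z - T w| + n%:R * c <= d.
  apply: (defect_iter (shrinking_nonexpansive sT) e0) => // x y xy.
  by apply: cT; rewrite xy.
apply: le_trans (_ : d - n%:R * c <= _); first by rewrite lerBrDr.
rewrite mulrBl mul1r lerD2l lerN2 mulrAC ler_pdivrMr ?mulr_gt0 //.
have dn' : d <= n.+1%:R * e by rewrite -ler_pdivrMr // ltW.
have -> : n%:R * c * (2 * e) = c * (2 * n%:R * e) by ring.
rewrite ler_pM2l //; apply: le_trans dn' _; rewrite ler_pM2r // -natr1; lra.
Qed.

(** Vanishing defects force the distances |x n - y n| themselves to 0, and nonexpansiveness carries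
    this over to the images. *)
Lemma shrinking_strongly_nonexpansive T :
  shrinking T -> strongly_nonexpansive T.
Proof.
move=> sT; have nT := shrinking_nonexpansive sT.
split=> // x y _ /cvgrPdist_lt dxy.
suff xy0 : x n - y n @[n --> \oo] --> (0 : X).
  rewrite -[0]subr0; apply: cvgB => //.
  apply/norm_cvg0P.
  apply: (@squeeze_cvgr _ _ _ _ (cst 0) (fun n => `|x n - y n|)).
  - by apply: nearW => n; rewrite normr_ge0 nT.
  - exact: cvg_cst.
  - exact/norm_cvg0P.
apply/cvgrPdist_lt => e e0; have [c c0 cT] := sT e e0.
have := dxy c c0; apply: filterS => n; rewrite !sub0r !normrN => h.
rewrite ltNge; apply/negP => /cT; rewrite leNgt => /negP; apply.
by rewrite -ltrBlDl; apply: le_lt_trans h; apply: ler_norm.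
Qed.

(* If the defects were not bounded below, they could be made to vanish along
   pairs at the fixed distance e, and adding the two conclusions of strong
   nonexpansiveness would force the distances to 0. *)
Lemma strongly_nonexpansive_shrinking T : strongly_nonexpansive T ->
  strongly_nonexpansive (fun z => - T z) -> shrinking T.
Proof.
move=> [nT sT] [_ sNT]; apply: shrinking_sphere => // e e0.
apply: contrapT => bad.
have pairs n : exists p : X * X, `|p.1 - p.2| = e /\
    `|p.1 - p.2| < `|T p.1 - T p.2| + n.+1%:R^-1.
  apply: contrapT => nop; apply: bad; exists n.+1%:R^-1 => // z w zw.
  by rewrite leNgt; apply/negP => lt; apply: nop; exists (z, w).
have [p pP] := choice pairs.
pose x n := (p n).1; pose y n := (p n).2.
have bxy : bounded_fun (fun n => x n - y n).
  exists e; split; first exact: num_real.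
  by move=> M eM n _; rewrite /= (pP n).1 ltW.
have dxy : `|x n - y n| - `|T (x n) - T (y n)| @[n --> \oo] --> (0 : R).
  apply: (@squeeze_cvgr _ _ _ _ (cst 0) (fun n => n.+1%:R^-1)).
  - apply: nearW => n; rewrite subr_ge0 nT /= lerBlDl ltW //.
    exact: (pP n).2.
  - exact: cvg_cst.
  - exact: cvg_harmonic.
have dNxy : `|x n - y n| - `|- T (x n) - - T (y n)| @[n --> \oo] --> (0 : R).
  by under eq_fun do rewrite -opprD normrN.
have sum n : (x n - y n - (T (x n) - T (y n)))
    + (x n - y n - (- T (x n) - - T (y n))) = 2 *: (x n - y n).
  rewrite -opprD opprK scaler_nat mulr2n.
  by rewrite [_ + (T _ - _)]addrC addrA subrK.
have : 2 *: (x n - y n) @[n --> \oo] --> (0 + 0 : X).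
  by under eq_fun do rewrite -sum; apply: cvgD; [apply: sT|apply: sNT].
rewrite addr0 => /cvg_norm; under eq_fun do rewrite normrZ (pP _).1.
move=> /(cvg_lim (@Rhausdorff R)); rewrite lim_cst // normr0 => /eqP.
by rewrite mulf_eq0 normr_eq0 (gt_eqF e0) pnatr_eq0.
Qed.

End ShrinkingMaps.

(** Picard iteration from 0. The displacements [d n] decrease, and lose a fixed amount as long as
    they stay above [e], so they tend to 0; this makes the iterates Cauchy. *)
Lemma shrinking_fixpoint {R : realType} {X : completeNormedModType R}
  (T : X -> X) : shrinking T -> exists z, T z = z.
Proof.
move=> sT; have nT := shrinking_nonexpansive sT.
pose z n := iter n T 0; pose d n := `|T (z n) - z n|.
have d_anti m n : (m <= n)%N -> d n <= d m.
  move=> /subnK <-; elim: (n - m)%N => // k; apply: le_trans.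
  by rewrite addSn; apply: nT.
have d_small (e : R) : 0 < e -> exists N, forall n, (N <= n)%N -> d n < e.
  move=> e0; suff [N dN] : exists N, d N < e.
    by exists N => n /d_anti h; apply: le_lt_trans dN.
  apply: contrapT => big; have [c c0 cT] := sT e e0.
  have dec n : d n + n%:R * c <= d 0.
    elim: n => [|n IHn]; first by rewrite mul0r addr0.
    have : d n.+1 + c <= d n.
      by apply: cT; rewrite leNgt; apply/negP => dn; apply: big; exists n.
    by rewrite -natr1 mulrDl mul1r; lra.
  have : d 0%N / c < (Num.truncn (d 0%N / c)).+1%:R by exact: truncnS_gt.
  set n := (Num.truncn _).+1; rewrite ltr_pdivrMr // => dn.
  have := dec n; have := normr_ge0 (T (z n) - z n); rewrite -/(d n); lra.
have /cvg_ex[l zl] : cvgn z.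
  apply: cauchy_cvgn => e e0; have [c c0 cT] := sT e e0.
  (* The defect of the pair [z N], [z n] is at most [d N + d n], hence below [c], which excludes a
     distance of [e] or more. *)
  have c20 : 0 < c / 2 by rewrite divr_gt0.
  have [N dN] := d_small _ c20; exists N => n Nn.
  rewrite ltNge; apply/negP => /cT.
  have := dN N (leqnn N); have := dN n Nn; rewrite /d (distrC (T (z N))).
  have := ler_distD (T (z N)) (z N) (z n).
  have := ler_distD (T (z n)) (T (z N)) (z n).
  lra.
exists l; apply/eqP; rewrite -subr_eq0 -normr_le0.
apply/ler_addgt0Pr => e e0; rewrite add0r.
have e40 : 0 < e / 4 by rewrite divr_gt0.
have [N dN] := d_small _ e40.
have /cvgrPdist_lt/(_ _ e40)[M _ zM] := zl.
pose n := maxn N M.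
have := dN n (leq_maxl _ _); have := zM n (leq_maxr _ _).
have := nT l (z n); have := ler_distD (T (z n)) (T l) l.
have := ler_distD (z n) (T (z n)) l; rewrite /d /= (distrC (z n) l).
lra.
Qed.

(** * Uniform continuity and moduli of monotonicity *)

Section UniformContinuity.
Context {R : realType} {X : normedModType R}.

Lemma unif_continuous_norm (T : X -> X) : unif_continuous T <->
  forall e : R, 0 < e -> exists2 r : R, 0 < r &
    forall x y, `|x - y| < r -> `|T x - T y| < e.
Proof.
split=> [/unif_continuousP uT e /uT[r r0 rT]|uT].
  exists r => // x y; have := rT (x, y).
  by rewrite -!ball_normE.
apply/unif_continuousP => e /uT[r r0 rT]; exists r => // -[x y].
by rewrite -!ball_normE; apply: rT.
Qed.

End UniformContinuity.

Section Moduli.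
Context {R : realType} {X : normedModType R}.
Variable dot : {dot X for idfun}.
Implicit Types (A : X -> set X) (x y u v : X).

(** Real-valued form of uniform monotonicity, with a separate constant for each [e] in place of a
    modulus. *)
Definition monotone_gap A := forall e : R, 0 < e -> exists2 c : R, 0 < c &
  forall x y u v, A x u -> A y v -> e <= `|x - y| -> c <= dot (x - y) (u - v).

Definition monotone_quadratic_gap A := forall e : R, 0 < e ->
  exists2 c : R, 0 < c & forall x y u v, A x u -> A y v ->
    e <= `|x - y| -> c * `|x - y| ^+ 2 <= dot (x - y) (u - v).

Lemma uniformly_monotone_gap A : uniformly_monotone dot A -> monotone_gap A.
Proof.
move=> [phi [phi0 phi_mono phi_eq0] phiA] e e0.
have : (0%:E < phi e)%E.
  rewrite lt_neqAle phi0 ?ltW // andbT eq_sym; apply/eqP.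
  move=> /phi_eq0; rewrite ltW // => /(_ isT) e_eq0.
  by rewrite e_eq0 ltxx in e0.
have le_dot x y u v : A x u -> A y v -> e <= `|x - y| ->
    (phi e <= (dot (x - y) (u - v))%:E)%E.
  move=> Axu Ayv exy; apply: le_trans (phiA x y u v Axu Ayv).
  by apply: phi_mono => //; apply: ltW.
(* If [phi e] is infinite, no two graph points are [e] apart in the domain, so any constant will
   do. *)
case: (phi e) le_dot => [c||] // le_dot c0.
  by exists c => // x y u v Axu Ayv /(le_dot _ _ _ _ Axu Ayv).
by exists 1 => // x y u v Axu Ayv /(le_dot _ _ _ _ Axu Ayv).
Qed.

(** The largest candidate for a modulus of [A]. It is [+oo] where the infimum is over the empty set;
    the value at 0 is set by hand because this could also happen there, for an empty graph. *)
Definition best_modulus A (t : R) : \bar R := if t <= 0 then 0%:E else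
  ereal_inf [set r | exists x y u v,
    [/\ A x u, A y v, t <= `|x - y| & r = (dot (x - y) (u - v))%:E]].

(** The quadratic bound passes to the infimum: started at [t] itself it makes the modulus positive
    at [t], started at 1 it makes it supercoercive. *)
Lemma quadratic_gap_supercoercive A : monotone_op dot A ->
  monotone_quadratic_gap A -> supercoercively_uniformly_monotone dot A.
Proof.
move=> mA gA.
have quad (e : R) : 0 < e -> exists2 c : R, 0 < c &
    forall t, e <= t -> ((c * t ^+ 2)%:E <= best_modulus A t)%E.
  move=> e0; have [c c0 cA] := gA e e0; exists c => // t et.
  rewrite /best_modulus (leNgt t 0) (lt_le_trans e0 et) /=.
  apply: le_ereal_inf_tmp => _ [x [y [u [v [Axu Ayv txy ->]]]]].
  rewrite lee_fin; apply: le_trans (cA x y u v Axu Ayv (le_trans et txy)).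
  by rewrite ler_pM2l // ler_sqr ?nnegrE // (le_trans _ et) // ltW.
have ge0 t : (0%:E <= best_modulus A t)%E.
  rewrite /best_modulus; case: ifP => // _.
  by apply: le_ereal_inf_tmp => _ [x [y [u [v [Axu Ayv _ ->]]]]]; exact: mA.
exists (best_modulus A); split; first split=> //.
- move=> s t s0 st; rewrite {1}/best_modulus; case: ifPn => // s_gt0.
  have t_gt0 : ~~ (t <= 0) by rewrite -ltNge (lt_le_trans _ st) // ltNge.
  rewrite /best_modulus (negbTE t_gt0); apply: ereal_inf_le_tmp.
  move=> _ [x [y [u [v [Axu Ayv txy ->]]]]].
  by exists x, y, u, v; split=> //; apply: le_trans txy.
- move=> t t0; split=> [phit|->]; last by rewrite /best_modulus lexx.
  apply/eqP; rewrite eq_le t0 andbT leNgt; apply/negP => t_gt0.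
  have [c c0 /(_ t (lexx t))] := quad t t_gt0; rewrite phit lee_fin leNgt.
  by rewrite mulr_gt0 // exprn_gt0.
- have [c c0 cphi] := quad 1 ltr01.
  apply/cvgeyPge => M; near=> t.
  have t1 : 1 <= t by near: t; apply: nbhs_pinfty_ge; rewrite num_real.
  have t0 : 0 < t by apply: lt_le_trans t1.
  have Mt : M / c <= t by near: t; apply: nbhs_pinfty_ge; rewrite num_real.
  apply: (@le_trans _ _ ((c * t ^+ 2)%:E * (t^-1)%:E)%E).
    by rewrite -EFinM lee_fin expr2 mulrA mulfK ?gt_eqF // mulrC -ler_pdivrMr.
  by apply: lee_wpmul2r; [rewrite lee_fin invr_ge0 ltW|exact: cphi].
- move=> x y u v Axu Ayv; rewrite /best_modulus; case: ifP => _.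
    by rewrite lee_fin; apply: mA Axu Ayv.
  by apply: ereal_inf_lbound; exists x, y, u, v.
Unshelve. all: by end_near.
Qed.

Lemma supercoercive_uniformly_monotone A :
  supercoercively_uniformly_monotone dot A -> uniformly_monotone dot A.
Proof. by move=> [phi [phim _ phiA]]; exists phi. Qed.

(** By uniform continuity, values at distance [e] come from points at some distance [r], where the
    gap of [A] applies. *)
Lemma uniformly_continuous_gap_inv A : uniformly_continuous_op A ->
  monotone_gap A -> monotone_gap (invop A).
Proof.
move=> [T AT /unif_continuous_norm uT] gA e e0.
have [r r0 rT] := uT e e0; have [c c0 cA] := gA r r0.
exists c => // u v x y Axu Ayv euv.
rewrite dotC; apply: cA => //; rewrite leNgt; apply/negP => /rT.
by move: Axu Ayv; rewrite /invop /= !AT /= => <- <-; rewrite ltNge euv.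
Qed.

End Moduli.

(** * The reflected resolvent and its defect *)

Section ReflectedResolvent.
Context {R : realType} {X : completeNormedModType R}.
Variable dot : {dot X for idfun}.
Hypothesis norm_dot : forall x : X, `|x| = Num.sqrt (dot x x).
Implicit Types (A : X -> set X) (N : X -> X) (x y u v z : X).

Lemma reflected_resolventP A z r : reflected_resolvent A z r <->
  exists x u, [/\ A x u, z = x + u & r = x - u].
Proof.
split=> [[x [u Axu <-] <-]|[x [u [Axu -> ->]]]].
  exists x, u; split=> //.
  by rewrite scaler_nat mulr2n opprD addrACA subrr add0r.
by exists x; [exists u|rewrite scaler_nat mulr2n opprD addrA addrK].
Qed.

(** Exchanging [x] and [u] keeps x + u and changes the sign of x - u. *)
Lemma reflected_resolvent_inv A N :
  (forall z, reflected_resolvent A z = [set N z]) ->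
  forall z, reflected_resolvent (invop A) z = [set - N z].
Proof.
move=> AN z.
have : reflected_resolvent A z (N z) by rewrite AN.
move=> /reflected_resolventP[x [u [Axu zE NzE]]].
apply/seteqP; split=> [r|_ ->]; last first.
  apply/reflected_resolventP; exists u, x.
  by split; rewrite // ?NzE ?opprB // addrC.
move=> /reflected_resolventP[v [y [Ayv z_vy ->]]] /=.
have : reflected_resolvent A z (y - v).
  by apply/reflected_resolventP; exists y, v; split=> //; rewrite addrC.
by rewrite AN => <-; rewrite opprB.
Qed.

Lemma reflected_resolvent_graph A N :
  (forall z, reflected_resolvent A z = [set N z]) ->
  forall x u, A x u -> N (x + u) = x - u.
Proof.
move=> AN x u Axu; have : reflected_resolvent A (x + u) (x - u).
  by apply/reflected_resolventP; exists x, u.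
by rewrite AN.
Qed.

Lemma is_map_such_that_eq (P : (X -> X) -> Prop) A N :
  (forall z, A z = [set N z]) -> is_map_such_that P A -> P N.
Proof.
move=> AN [T AT PT]; suff -> : N = T by [].
apply/funext => z; have : A z (N z) by rewrite AN.
by rewrite AT.
Qed.

Lemma reflected_resolvent_exists A : maximally_monotone dot A ->
  exists N, forall z, reflected_resolvent A z = [set N z].
Proof.
move=> maxA; have [mA _] := maxA.
have [J JA] := choice (fun z => minty norm_dot z maxA).
exists (fun z => J z - (z - J z)) => z.
apply/seteqP; split=> [r|_ ->]; last first.
  apply/reflected_resolventP; exists (J z), (z - J z).
  by split; rewrite // addrC subrK.
move=> /reflected_resolventP[x [u [Axu zE ->]]] /=.
have uE : u = z - x by rewrite zE addrC addKr.
suff xJ : x = J z by rewrite uE xJ.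
(* Monotonicity between [(x, z - x)] and [(J z, z - J z)] says that -|x - J z|^2 is nonnegative. *)
have := mA _ _ _ _ Axu (JA z).
have -> : u - (z - J z) = - (x - J z).
  by rewrite uE opprB addrC addrA subrK opprB.
rewrite dotNr -(normX2 norm_dot) oppr_ge0.
move=> xJ; apply/eqP; rewrite -subr_eq0 -normr_eq0 -sqrf_eq0 eq_le xJ.
exact: exprn_ge0.
Qed.

Lemma norm_sqr_reflect x u y v :
  `|(x + u) - (y + v)| ^+ 2 - `|(x - u) - (y - v)| ^+ 2 =
    4 * dot (x - y) (u - v).
Proof.
rewrite !(normX2 norm_dot) opprD opprB.
have -> : x + u + (- y - v) = (x - y) + (u - v) by rewrite addrACA.
have -> : x - u + (v - y) = (x - y) - (u - v) 
  by rewrite opprB [v - y]addrC addrACA [- u + v]addrC.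
move: (x - y) (u - v) => a b; rewrite !dotE (dotC dot b a); ring.
Qed.

Section FixedOperator.
Context (A : X -> set X) (N : X -> X).
Hypothesis mA : monotone_op dot A.
Hypothesis AN : forall z, reflected_resolvent A z = [set N z].

Lemma reflected_resolvent_decomp z :
  exists x u, [/\ A x u, z = x + u & N z = x - u].
Proof. by apply/reflected_resolventP; rewrite AN. Qed.

Lemma reflected_resolvent_nonexpansive : nonexpansive N.
Proof.
move=> z w.
have [x [u [Axu -> ->]]] := reflected_resolvent_decomp z.
have [y [v [Ayv -> ->]]] := reflected_resolvent_decomp w.
rewrite -ler_sqr ?nnegrE // -subr_ge0 norm_sqr_reflect mulr_ge0 //.
exact: mA Axu Ayv.
Qed.

(** If |a + b| = e for a = x - y and b = u - v, then |a| or |b| is at least e / 2, and the gap of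
    [A] or of its inverse bounds <a, b> below. *)
Lemma gap_shrinking :
  monotone_gap dot A -> monotone_gap dot (invop A) -> shrinking N.
Proof.
move=> gA gA'; apply: shrinking_sphere => [|e e0].
  exact: reflected_resolvent_nonexpansive.
have e20 : 0 < e / 2 by rewrite divr_gt0.
have [c c0 cA] := gA _ e20; have [c' c'0 cA'] := gA' _ e20.
pose k := Num.min c c'; have k0 : 0 < k by rewrite lt_min c0.
(* With [t] the distance of the images, (e - t)(e + t) >= 4 k and e + t <= 2 e. *)
exists (2 * k / e); first by rewrite divr_gt0 // mulr_gt0.
move=> z w.
have [x [u [Axu -> ->]]] := reflected_resolvent_decomp z.
have [y [v [Ayv -> ->]]] := reflected_resolvent_decomp w.
move=> s_eq; have := norm_sqr_reflect x u y v.
have kab : k <= dot (x - y) (u - v).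
  have [xy|xy] := leP (e / 2) `|x - y|.
    by rewrite /k ge_min cA.
  rewrite /k ge_min dotC cA' ?orbT //.
  have := ler_normD (x - y) (u - v); rewrite addrACA -opprD s_eq; lra.
rewrite s_eq; set t := `|_ - _| => et.
have t0 : 0 <= t by exact: normr_ge0.
have kE : 2 * k / e * e = 2 * k by rewrite divfK // gt_eqF.
have te : t <= e by rewrite -ler_sqr ?nnegrE ?(ltW e0) //; lra.
rewrite -subr_ge0 -(pmulr_lge0 _ e0); nra.
Qed.

(** With a = x - y, b = u - v, s = |a + b| and t = |a - b|, monotonicity gives |a| <= s, so the
    contraction estimate applies at distance s. Then 4 <a, b> = (s - t)(s + t) >= (1 - K) s^2 >= (1
    - K) |a|^2. *)
Lemma contraction_quadratic_gap :
  contraction_for_large_distances N -> monotone_quadratic_gap dot A.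
Proof.
move=> cN e e0; have [K K1 KN] := cN e e0.
exists ((1 - K) / 4); first by rewrite divr_gt0 // subr_gt0.
move=> x y u v Axu Ayv exy.
have ab0 : 0 <= dot (x - y) (u - v) by exact: mA Axu Ayv.
have := norm_sqr_reflect x u y v.
have := KN (x + u) (y + v); rewrite !(reflected_resolvent_graph AN) //.
set s := `|x + u - _|; set t := `|x - u - _|; set d := `|x - y|.
have t0 : 0 <= t by exact: normr_ge0.
have d0 : 0 <= d by exact: normr_ge0.
have s0 : 0 <= s by exact: normr_ge0.
have ds : d <= s.
  rewrite -ler_sqr ?nnegrE // !(normX2 norm_dot).
  have -> : x + u - (y + v) = (x - y) + (u - v) by rewrite opprD addrACA.
  move: (x - y) (u - v) ab0 => a b ab0.
  have := dotxx_ge0 dot b; rewrite !dotE (dotC dot b a); lra.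
move=> /(_ (le_trans exy ds)) ts st.
have s_gt0 : 0 < s := lt_le_trans e0 (le_trans exy ds).
have ts1 : t <= s by apply: le_trans ts _; rewrite ger_pMl // ltW.
have dd : d ^+ 2 <= s ^+ 2 by rewrite ler_sqr.
have h1 : (1 - K) * d ^+ 2 <= (1 - K) * s ^+ 2 by rewrite ler_pM2l // subr_gt0.
have h2 : (1 - K) * s * s <= (s - t) * s by rewrite ler_wpM2r //; lra.
have h3 : (s - t) * s <= (s - t) * (s + t).
  by rewrite ler_wpM2l ?subr_ge0 // lerDl.
rewrite -(ler_pM2l (x := 4)) //; lra.
Qed.

(* u is a value of A as soon as z |-> N z + 2 u has a fixed point. *)
Lemma contraction_inv_uniformly_continuous :
  contraction_for_large_distances N -> uniformly_continuous_op (invop A).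
Proof.
move=> cN; have gA := contraction_quadratic_gap cN.
have surjA u : exists x, A x u.
  have /shrinking_fixpoint[z zfix] :=
    shrinking_translate (2 *: u) (contraction_shrinking cN).
  have [x [v [Axv zE NzE]]] := reflected_resolvent_decomp z.
  exists x; suff <- : v = u by [].
  apply: (@scalerI _ _ (2 : R)); first by rewrite pnatr_eq0.
  have -> : 2 *: u = z - N z by rewrite -{1}zfix addrC addKr.
  by rewrite NzE zE opprB [x + v]addrC addrACA subrr addr0 scaler_nat mulr2n.
have [T TA] := choice surjA.
(* The quadratic gap and Cauchy-Schwarz give c |x - y| <= |u - v|. This yields uniform continuity of
   the inverse and, for u = v, its single-valuedness. *)
have bound e : 0 < e -> exists2 c : R, 0 < c & forall x y u v,
    A x u -> A y v -> e <= `|x - y| -> c <= `|u - v|.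
  move=> e0; have [c c0 cA] := gA e e0; exists (c * e); first exact: mulr_gt0.
  move=> x y u v Axu Ayv exy; have xy0 := lt_le_trans e0 exy.
  have := le_trans (cA _ _ _ _ Axu Ayv exy) (CauchySchwarz norm_dot _ _).
  rewrite expr2 mulrCA ler_pM2l //; apply: le_trans.
  by rewrite ler_pM2l.
exists T; last first.
  apply/unif_continuous_norm => e /bound[c c0 cA]; exists c => // u v uv.
  rewrite ltNge; apply/negP => /(cA _ _ _ _ (TA u) (TA v)).
  by rewrite leNgt uv.
move=> u; apply/seteqP; split=> [x Axu|_ -> //] /=.
apply/eqP; rewrite -subr_eq0 -normr_eq0 eq_le normr_ge0 andbT leNgt.
apply/negP => /bound[c c0 /(_ _ _ _ _ Axu (TA u) (lexx _))].
by rewrite subrr normr0 leNgt c0.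
Qed.

End FixedOperator.
End ReflectedResolvent.

(** * The cycle of implications *)

Theorem theorem6p3 (R : realType) (X : completeNormedModType R)
    (dot : {dot X for idfun})
    (norm_dot : forall x : X, `|x| = Num.sqrt (dot x x))
    (A : X -> set X) (Amax : maximally_monotone dot A) :
  [<-> uniformly_monotone dot A /\ uniformly_continuous_op A;
       is_map_such_that contraction_for_large_distances
         (reflected_resolvent A);
       supercoercively_uniformly_monotone dot A /\
       supercoercively_uniformly_monotone dot (invop A);
       uniformly_monotone dot A /\ uniformly_monotone dot (invop A);
       uniformly_monotone dot (invop A) /\ uniformly_continuous_op (invop A);
       is_map_such_that strongly_nonexpansive (reflected_resolvent A) /\
       is_map_such_that strongly_nonexpansive
         (reflected_resolvent (invop A))].
Proof.
have Amax' := maximally_monotone_inv Amax.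
have [mA _] := Amax; have [mA' _] := Amax'.
have [N AN] := reflected_resolvent_exists norm_dot Amax.
have AN' := reflected_resolvent_inv AN.
have shrink := gap_shrinking norm_dot mA AN.
have contract sN := shrinking_contraction (sN : shrinking N).
have contract' sN := shrinking_contraction (shrinkingN (sN : shrinking N)).
have coercive sN := quadratic_gap_supercoercive mA
  (contraction_quadratic_gap norm_dot mA AN (contract sN)).
have coercive' sN := quadratic_gap_supercoercive mA'
  (contraction_quadratic_gap norm_dot mA' AN' (contract' sN)).
tfae.
- move=> [/uniformly_monotone_gap gA ucA]; exists N => //; apply: contract.
  exact: shrink gA (uniformly_continuous_gap_inv ucA gA).
- move=> /(is_map_such_that_eq AN)/contraction_shrinking sN.
  by split; [exact: coercive|exact: coercive'].
- by move=> [? ?]; split; apply: supercoercive_uniformly_monotone.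
- move=> [/uniformly_monotone_gap gA umA']; split=> //.
  apply: (contraction_inv_uniformly_continuous norm_dot mA AN).
  exact/contract/shrink/uniformly_monotone_gap.
- move=> [/uniformly_monotone_gap gA' ucA'].
  have sN : shrinking N.
    by apply: shrink => //; apply: (uniformly_continuous_gap_inv ucA' gA').
  split; first by exists N => //; apply: shrinking_strongly_nonexpansive.
  exists (fun z => - N z) => //.
  exact/shrinking_strongly_nonexpansive/shrinkingN.
- move=> [/(is_map_such_that_eq AN) sN /(is_map_such_that_eq AN') sN'].
  have {}sN := strongly_nonexpansive_shrinking sN sN'.
  split; first exact/supercoercive_uniformly_monotone/coercive.
  (* Applied to the inverse, whose reflected resolvent is - N; [invop (invop A)] is convertible to
     [A]. *)
  exact: (contraction_inv_uniformly_continuous norm_dot mA' AN' (contract' sN)).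
Qed.
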